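(* Let $s_1,s_2$ be positive integers and $a,\alpha\in\mathbb R$. Then the derivatives (first definition) commute: for $x>0$, $$\frac{d^{s_1}}{dx^{s_1}}\frac{d^{s_2}(ax^\alpha)}{dx^{s_2}}=\frac{d^{s_2}}{dx^{s_2}}\frac{d^{s_1}(ax^\alpha)}{dx^{s_1}}=\frac{d^{s_1+s_2}(ax^\alpha)}{dx^{s_1+s_2}}.$$
   Context: First definition. For $(s,\alpha)\in\mathbb Q\times\mathbb R\setminus\{(-1,-1)\}$ and $a\in\mathbb R$, a derivative of order $s$ of $ax^\alpha$ ($x>0$) is any function of the form $$\frac{d^s(ax^\alpha)}{dx^s}=a\frac{\Gamma(\alpha+1)}{\Gamma(\alpha-s+1)}x^{\alpha-s}+\sum_{k=-\infty}^{-1}c_k\frac{x^{k-s}}{\Gamma(k-s+1)},$$ with arbitrary real constants $c_k$. Conventions: $1/\Gamma(z)=0$ for $z\in\{0,-1,-2,\dots\}$ (so for positive integer $s$ the sum vanishes); $\Gamma(\alpha+1)/\Gamma(\alpha-s+1)$ means $\lim_{z\to\alpha}\Gamma(z+1)/\Gamma(z-s+1)$. *)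

(* Defs.v *)
From HB Require Import structures.
From mathcomp Require Import all_boot all_order all_algebra.
From mathcomp Require Import all_classical all_reals all_analysis.

Set Implicit Arguments.
Unset Strict Implicit.
Unset Printing Implicit Defensive.

Import Order.TTheory GRing.Theory Num.Theory.
Import numFieldNormedType.Exports.

Local Open Scope classical_set_scope.
Local Open Scope ring_scope.

Definition Gamma_integral (R : realType) (x : R) : R :=
  \int[@lebesgue_measure R]_(t in `]0, +oo[) (t `^ (x - 1) * expR (- t)).

(* For x <= 0, extension by Gamma (x + n) = x (x + 1) .. (x + n - 1) Gamma x,
   where n is the least natural number such that 0 < x + n.
   At the poles 0, -1, -2, .. the product vanishes, so that both Gamma x and
   (Gamma x)^-1 are 0: the second value is the convention 1 / Gamma x = 0; the
   first one is a dummy. *)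
Definition Gamma (R : realType) (x : R) : R :=
  if 0 < x then Gamma_integral x
  else let n := (Num.truncn (- x)).+1 in
       Gamma_integral (x + n%:R) / \prod_(i < n) (x + i%:R).

(* Functions of x > 0 are functions on {posnum R}. *)
Definition monomial (R : realType) (a alpha : R) : {posnum R} -> R :=
  fun x => a * x%:num `^ alpha.

(* The term of index k = - (j + 1) of the sum over the negative integers k;
   c j stands for the constant c_k. *)
Definition complementary_term (R : realType) (s : rat) (c : nat -> R) (x : R)
    (j : nat) : R :=
  let k : R := - j.+1%:R in
  c j * (x `^ (k - ratr s) / Gamma (k - ratr s + 1)).

(* The set of all the derivatives of order s of a x^alpha. The coefficient
   Gamma (alpha + 1) / Gamma (alpha - s + 1) is the limit l over z -> alpha,
   z != alpha; there is no derivative when this limit is not finite. *)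
Definition deriv_monomial (R : realType) (s : rat) (a alpha : R) :
    set ({posnum R} -> R) :=
  [set g | (s, alpha) <> (-1, -1) /\
    exists (l : R) (c : nat -> R),
      Gamma (z + 1) / Gamma (z - ratr s + 1) @[z --> alpha^'] --> l /\
      forall x : {posnum R},
        cvgn (series (complementary_term s c x%:num)) /\
        g x = a * l * x%:num `^ (alpha - ratr s)
              + limn (series (complementary_term s c x%:num))].

(* The set of all the derivatives of order s of the members of F, where only
   the functions of the form b x^beta have derivatives. *)
Definition deriv_set (R : realType) (s : rat) (F : set ({posnum R} -> R)) :
    set ({posnum R} -> R) :=
  [set g | exists b beta : R, F (monomial b beta) /\ deriv_monomial s b beta g].

(* Main.v *)
Require Import Defs.
From HB Require Import structures.
From mathcomp Require Import all_boot all_order all_algebra.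
From mathcomp Require Import all_classical all_reals all_analysis.
From mathcomp Require Import measurable_realfun.
Import Order.TTheory GRing.Theory Num.Theory.
Import numFieldNormedType.Exports.
Local Open Scope classical_set_scope.
Local Open Scope ring_scope.

(** At a positive integer order [n], a monomial [a x ^ alpha] has exactly one
    derivative, [a alpha (alpha - 1) .. (alpha - n + 1) x ^ (alpha - n)]
    ([deriv_monomial_nat]); commutation and additivity of the orders then come
    from the identity [falling_factorialD] for falling factorials.

    Uniqueness has two sources. The complementary sum vanishes, because it only
    involves [1 / Gamma] at negative integers. The coefficient
    [Gamma (z + 1) / Gamma (z - n + 1)] has a limit at [alpha], unique since the
    line is Hausdorff: for non-integer [z], hence for all [z] near [alpha] and
    distinct from it, iterating [Gamma (z + 1) = z Gamma z] shows that the
    quotient is the falling factorial polynomial, which is continuous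
    ([cvg_Gamma_ratio]).

    Two facts on Euler's integral are needed, for positive arguments: it
    satisfies [Gamma (x + 1) = x Gamma x], by integration by parts, and it is
    finite and nonzero ([Gamma_integralD1], [Gamma_integral_gt0]). The
    functional equation extends to non-integer negative arguments by
    shifting to the right far enough ([Gamma_shiftE]).

    Composing derivatives requires writing the first one as a monomial. The
    representation is unique unless that derivative is zero; then the exponent
    is arbitrary, but all further derivatives are zero
    ([deriv_set_deriv_monomial]). *)

(** * Euler's integral *)

Section Euler_integral.
Context {R : realType}.
Implicit Types (x t : R).
Notation mu := (@lebesgue_measure R).

Definition Gamma_integrand x t : R := t `^ (x - 1) * expR (- t).

(** The extended-real value is used until finiteness is known: in the extended
    reals the recurrence below holds without any integrability assumption, so
    that it can serve to prove finiteness itself. *)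
Definition eGamma x : \bar R :=
  (\int[mu]_(t in `]0%R, +oo[) (Gamma_integrand x t)%:E)%E.

Lemma Gamma_integrand_ge0 x t : 0 <= Gamma_integrand x t.
Proof. by rewrite mulr_ge0 ?powR_ge0 ?expR_ge0. Qed.

Lemma measurable_Gamma_integrand x (D : set R) :
  measurable_fun D (fun t : R => (Gamma_integrand x t)%:E).
Proof.
apply/measurable_EFinP/measurable_funTS; apply: measurable_funM.
  exact: measurable_powR.
exact: measurableT_comp.
Qed.

Lemma eGamma_ge0 x : (0 <= eGamma x)%E.
Proof. by apply: integral_ge0 => t _; rewrite lee_fin Gamma_integrand_ge0. Qed.

Lemma continuous_expRN : continuous (fun t : R => expR (- t)).
Proof.
move=> t; apply: continuous_comp; first exact: opp_continuous.
exact: continuous_expR.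
Qed.

Lemma eGamma1 : eGamma 1 = 1%E.
Proof.
rewrite /eGamma /Gamma_integrand subrr.
under eq_integral do rewrite powRr0 mul1r.
rewrite integral_itv_obnd_cbnd; last first.
  by apply/measurable_EFinP; exact: measurableT_comp.
rewrite (@ge0_continuous_FTC2y _ _ (fun t => - expR (- t)) _ 0).
- by rewrite oppr0 expR0 EFinN oppeK add0e.
- by move=> t _; exact: expR_ge0.
- by apply: continuous_subspaceT; exact: continuous_expRN.
- by rewrite -oppr0; apply: cvgN; exact: cvgr_expR.
- by move=> t _; exact: ex_derive.
- by apply: cvgN; apply/cvg_at_right_filter; exact: continuous_expRN.
- by move=> t _; rewrite derive1E derive_val mulrN1 opprK.
Qed.

(** Compact intervals away from [0], where the integrand may be unbounded:
    integration by parts applies on each of them. The shift by [2] makes all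
    of them nondegenerate. *)
Definition exhaustion (n : nat) : set R := `[n.+2%:R^-1, n.+2%:R].

Lemma bigcup_exhaustion : \bigcup_n exhaustion n = `]0, +oo[%classic.
Proof.
apply/seteqP; split => [t [n _]|t]; rewrite /exhaustion/= !in_itv/= andbT.
  by move=> /andP[+ _]; apply: lt_le_trans.
move=> t0; pose n := Num.truncn (Num.max t t^-1).
have : Num.max t t^-1 <= n.+2%:R.
  by rewrite ltW// (lt_trans (truncnS_gt _))// ltr_nat.
rewrite ge_max => /andP[tn tVn]; exists n => //.
by rewrite /= in_itv/= tn andbT invf_ple ?posrE.
Qed.

Lemma exhaustion_nondecreasing : nondecreasing_seq exhaustion.
Proof.
move=> m n mn; apply/subsetPset => t; rewrite /exhaustion/= !in_itv/=.
move=> /andP[mt tm]; rewrite (le_trans _ mt) ?(le_trans tm) ?ler_nat//.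
by rewrite lef_pV2 ?posrE// ler_nat.
Qed.

Lemma eGamma_cvg x :
  (\int[mu]_(t in exhaustion n) (Gamma_integrand x t)%:E)%E @[n --> \oo]
    --> eGamma x.
Proof.
rewrite /eGamma -bigcup_exhaustion; apply: ge0_nondecreasing_set_cvg_integral.
- exact: exhaustion_nondecreasing.
- by move=> n; exact: measurable_itv.
- by move=> n; exact: measurable_Gamma_integrand.
- by move=> n t _; rewrite lee_fin Gamma_integrand_ge0.
Qed.

(** The boundary term of the integration by parts. *)
Definition Gamma_boundary x t : R := t `^ x * expR (- t).

Lemma Gamma_boundary_cvg0 x : 0 < x ->
  Gamma_boundary x n.+2%:R^-1 @[n --> \oo] --> 0.
Proof.
move=> x0.
apply: (squeeze_cvgr (f := fun=> 0) (h := fun n => n.+2%:R^-1 `^ x)).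
- apply: nearW => n; rewrite /Gamma_boundary mulr_ge0 ?powR_ge0 ?expR_ge0//=.
  by rewrite ler_piMr ?powR_ge0// expR_le1 oppr_le0.
- exact: cvg_cst.
- have /cvg_at_rightP := powR_cvg0 x0; apply; split => //.
  have : (@harmonic R) n.+1 @[n --> \oo] --> 0.
    by rewrite cvg_shiftS; exact: cvg_harmonic.
  exact.
Qed.

(** With [m] an integer above [x], the bound [t ^ m.+1 / m.+1`! <= exp t] makes
    the boundary term at most [m.+1`! / t]. *)
Lemma Gamma_boundary_cvgy x : 0 < x ->
  Gamma_boundary x n.+2%:R @[n --> \oo] --> 0.
Proof.
move=> x0; pose m := (Num.truncn x).+1.
have xm : x <= m%:R by rewrite ltW// truncnS_gt.
apply: (squeeze_cvgr (f := fun=> 0) (h := fun n => m.+1`!%:R * harmonic n.+1)).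
- apply: nearW => n; rewrite /Gamma_boundary mulr_ge0 ?powR_ge0 ?expR_ge0//=.
  set t : R := n.+2%:R.
  have t0 : 0 < t by [].
  rewrite expRN ler_pdivrMr ?expR_gt0//.
  rewrite (@le_trans _ _ (t ^+ m))//.
    by rewrite -powR_mulrn// ler_powR// /t ler1n.
  have : t ^+ m.+1 / m.+1`!%:R <= expR t.
    by rewrite (le_trans _ (expR_ge1Dxn m (ltW t0)))// lerDr.
  rewrite ler_pdivrMr ?ltr0n ?fact_gt0// exprS mulrC -ler_pdivlMr//.
  by rewrite [expR t * _]mulrC mulrAC.
- exact: cvg_cst.
- rewrite -[X in _ --> X](mulr0 m.+1`!%:R); apply: cvgMl_tmp.
  by rewrite cvg_shiftS; exact: cvg_harmonic.
Qed.

(** Integration by parts on the compact intervals, then monotone convergence on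
    both sides. The boundary term is finite and tends to [0], hence the limit is
    legitimate even if the integrals diverge. *)
Lemma eGammaD1 x : 0 < x -> eGamma (x + 1) = (x%:E * eGamma x)%E.
Proof.
move=> x0.
have parts n : (\int[mu]_(t in exhaustion n) (Gamma_integrand (x + 1) t)%:E =
   (Gamma_boundary x n.+2%:R^-1 - Gamma_boundary x n.+2%:R)%:E +
   x%:E * \int[mu]_(t in exhaustion n) (Gamma_integrand x t)%:E)%E.
  have ab : n.+2%:R^-1 < n.+2%:R :> R.
    by rewrite (@lt_trans _ _ 1) ?invf_lt1 ?ltr1n.
  have a0 : 0 < n.+2%:R^-1 :> R by rewrite invr_gt0 ltr0n.
  have pos t : n.+2%:R^-1 <= t -> 0 < t by exact: lt_le_trans.
  have dpow t y : 0 < t -> derivable (@powR R ^~ y) t 1.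
    by move=> t0; apply: derivable_powR; rewrite in_itv/= andbT.
  have cpow t y : 0 < t -> {for t, continuous (@powR R ^~ y)}.
    by move=> t0; exact/differentiable_continuous/derivable1_diffP/dpow.
  have within_ab (f : R -> R) : (forall t, 0 < t -> {for t, continuous f}) ->
      {within exhaustion n, continuous f}.
    move=> cf; apply: continuous_in_subspaceT => t.
    by rewrite inE /exhaustion/= in_itv/= => /andP[/pos t0 _]; exact: cf.
  rewrite /exhaustion in within_ab *.
  under eq_integral do rewrite /Gamma_integrand addrK.
  rewrite (@integration_by_parts R (fun t => t `^ x) (fun t => - expR (- t))
    (fun t => x * t `^ (x - 1)) (fun t => expR (- t)) _ _ ab).
  - rewrite !mulrN opprK [(- _ + _)%R]addrC; congr (_ + _)%E.
    under eq_integral do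
      rewrite mulrN EFinN -mulrA EFinM -/(Gamma_integrand x _).
    rewrite integral_ge0N ?oppeK => [|t _]; last first.
      by rewrite mule_ge0// lee_fin ?(ltW x0)// Gamma_integrand_ge0.
    rewrite ge0_integralZl//.
    + exact: measurable_Gamma_integrand.
    + by move=> t _; rewrite lee_fin Gamma_integrand_ge0.
    + by rewrite lee_fin ltW.
  - apply: within_ab => t t0; apply: continuousM; first exact: cst_continuous.
    exact: cpow.
  - split.
    + by move=> t /[!in_itv]/= /andP[/ltW/pos t0 _]; exact: dpow.
    + by apply/cvg_at_right_filter/cpow.
    + by apply/cvg_at_left_filter/cpow; exact: lt_trans ab.
  - move=> t /[!in_itv]/= /andP[/ltW/pos t0 _].
    by rewrite powR_derive1 // in_itv/= andbT.
  - by apply: within_ab => t _; exact: continuous_expRN.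
  - split.
    + by move=> t _; exact: ex_derive.
    + by apply: cvgN; apply/cvg_at_right_filter; exact: continuous_expRN.
    + by apply: cvgN; apply/cvg_at_left_filter; exact: continuous_expRN.
  - by move=> t _; rewrite derive1E derive_val mulrN1 opprK.
suff lim_parts :
    (\int[mu]_(t in exhaustion n) (Gamma_integrand (x + 1) t)%:E)%E
      @[n --> \oo] --> (x%:E * eGamma x)%E.
  exact: cvg_unique (eGamma_cvg (x + 1)) lim_parts.
under eq_cvg do rewrite parts.
rewrite -(add0e (x%:E * eGamma x)%E); apply: cvgeD.
- by rewrite fin_num_adde_defr.
- apply: cvg_EFin; first exact: nearW.
  rewrite -(subrr (0 : R)).
  exact: cvgB (Gamma_boundary_cvg0 x x0) (Gamma_boundary_cvgy x x0).
- by apply: cvgeZl => //; exact: eGamma_cvg.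
Qed.

Lemma eGamma_nat_lty n : (eGamma n.+1%:R < +oo)%E.
Proof.
elim: n => [|n IH]; first by rewrite eGamma1 ltry.
by rewrite -natr1 eGammaD1// lte_mul_pinfty ?lee_fin.
Qed.

(** By the recurrence it suffices to treat [x >= 1]. There [t ^ (x - 1)] is at
    most [1] for [t <= 1] and at most [t ^ m] for [t >= 1], where [m] is an
    integer above [x - 1]; so the integral is at most the sum of its values at
    the positive integers [1] and [m + 1], which are finite by induction. *)
Lemma eGamma_lty x : 0 < x -> (eGamma x < +oo)%E.
Proof.
wlog x1 : x / 1 <= x => [ge1_lty x0|_].
  rewrite -(@lte_pmul2l _ x%:E) ?lte_fin// gt0_muley ?lte_fin// -eGammaD1//.
  by apply: ge1_lty; rewrite ?lerDr ?addr_gt0// ltW.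
pose m := Num.truncn x.
have xm : x - 1 <= m%:R by rewrite lerBlDr natr1 ltW// truncnS_gt.
apply: (@le_lt_trans _ _ (eGamma 1 + eGamma m.+1%:R)%E); last first.
  by rewrite lte_add_pinfty// ?eGamma1 ?ltry// eGamma_nat_lty.
rewrite /eGamma -ge0_integralD//; first last.
- exact: measurable_Gamma_integrand.
- by move=> t _; rewrite lee_fin Gamma_integrand_ge0.
- exact: measurable_Gamma_integrand.
- by move=> t _; rewrite lee_fin Gamma_integrand_ge0.
apply: ge0_le_integral => //.
- by move=> t _; rewrite lee_fin Gamma_integrand_ge0.
- exact: measurable_Gamma_integrand.
- by apply: emeasurable_funD; exact: measurable_Gamma_integrand.
move=> t; rewrite /= in_itv/= andbT => t0.
rewrite -EFinD lee_fin /Gamma_integrand -mulrDl ler_wpM2r ?expR_ge0//.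
rewrite subrr powRr0 -natr1 addrK.
have [t1|/ltW t1] := leP t 1.
  rewrite (@le_trans _ _ 1) ?lerDl ?powR_ge0//.
  by rewrite -[leRHS](powRr0 t) ger_powR ?t0// subr_ge0.
by rewrite (le_trans (ler_powR t1 xm))// lerDr.
Qed.

(** By the recurrence it suffices to treat [x >= 1], where the integrand is at
    least [exp (- 2)] on the interval [[1, 2]]. *)
Lemma eGamma_gt0 x : 0 < x -> (0 < eGamma x)%E.
Proof.
wlog x1 : x / 1 <= x => [ge1_gt0 x0|_].
  rewrite -(@lte_pmul2l _ x%:E) ?lte_fin// mule0 -eGammaD1//.
  by apply: ge1_gt0; rewrite ?lerDr ?addr_gt0// ltW.
apply: (@lt_le_trans _ _ (\int[mu]_(t in `[1%R, 2%R]) (expR (- 2))%:E)%E).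
  rewrite integral_cst//= lebesgue_measure_itv/= lte_fin ltr1n -EFinD.
  by rewrite -EFinM lte_fin mulr_gt0 ?expR_gt0// subr_gt0 ltr1n.
apply: (@le_trans _ _ (\int[mu]_(t in `[1%R, 2%R]) (Gamma_integrand x t)%:E)%E).
  apply: ge0_le_integral => //.
  - exact: measurable_Gamma_integrand.
  - move=> t; rewrite /= in_itv/= => /andP[t1 t2]; rewrite lee_fin.
    rewrite -[leLHS]mul1r ler_pM ?expR_ge0// ?ler_expR ?lerN2//.
    by rewrite -[leLHS](powRr0 t) ler_powR// subr_ge0.
apply: ge0_subset_integral => //.
- exact: measurable_Gamma_integrand.
- by move=> t _; rewrite lee_fin Gamma_integrand_ge0.
- by move=> t; rewrite /= !in_itv/= andbT => /andP[+ _]; exact: lt_le_trans.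
Qed.

Lemma Gamma_integralE x : Gamma_integral x = fine (eGamma x).
Proof. by []. Qed.

Lemma Gamma_integralD1 x : 0 < x ->
  Gamma_integral (x + 1) = x * Gamma_integral x.
Proof.
move=> x0; rewrite !Gamma_integralE eGammaD1// fineM//.
by rewrite ge0_fin_numE ?eGamma_lty// eGamma_ge0.
Qed.

Lemma Gamma_integral_gt0 x : 0 < x -> 0 < Gamma_integral x.
Proof. by move=> x0; rewrite fine_gt0// eGamma_gt0// eGamma_lty. Qed.

End Euler_integral.

(** * The Gamma function at non-integer arguments *)

Section Gamma_function.
Context {R : realType}.
Implicit Types (x z alpha : R).

Lemma Gamma_integralDn x n : 0 < x ->
  Gamma_integral (x + n%:R) = \prod_(i < n) (x + i%:R) * Gamma_integral x.
Proof.
move=> x0; elim: n => [|n IH]; first by rewrite addr0 big_ord0 mul1r.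
rewrite -natr1 addrA Gamma_integralD1 ?ltr_wpDr// IH big_ord_recr/=.
by rewrite mulrCA mulrA.
Qed.

Lemma nonintD z m : m \is a Num.int -> z \isn't a Num.int ->
  z + m \isn't a Num.int.
Proof. by move=> mi; apply: contra => zm; rewrite -(addrK m z) rpredB. Qed.

Lemma prod_shift_neq0 z n : z \isn't a Num.int ->
  \prod_(i < n) (z + i%:R) != 0.
Proof.
move=> zint; apply/prodf_neq0 => i _; rewrite addr_eq0; apply: contra zint.
by move=> /eqP ->; rewrite rpredN rpred_nat.
Qed.

(** Away from the integers, the value of [Gamma] does not depend on how far the
    argument is shifted to the right. Comparing values of [Gamma] at two points
    thus reduces to choosing shifts that reach the same point. *)
Lemma Gamma_shiftE z n : z \isn't a Num.int -> 0 < z + n%:R ->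
  Gamma z = Gamma_integral (z + n%:R) / \prod_(i < n) (z + i%:R).
Proof.
move=> zint zn0.
have indep m : (m <= n)%N -> 0 < z + m%:R ->
    Gamma_integral (z + m%:R) / \prod_(i < m) (z + i%:R) =
    Gamma_integral (z + n%:R) / \prod_(i < n) (z + i%:R).
  move=> /subnKC <- zm0.
  rewrite natrD addrA (Gamma_integralDn (z + m%:R))// big_split_ord/=.
  under [X in _ = _ / (_ * X)]eq_bigr do rewrite natrD addrA.
  rewrite [X in _ = X / _]mulrC -mulf_div divff ?mulr1//.
  by rewrite prod_shift_neq0// nonintD ?rpred_nat.
rewrite /Gamma; case: ltP => [z0|z0].
  by rewrite -(indep 0%N) ?addr0// big_ord0 invr1 mulr1.
apply: indep; last by rewrite -ltrBlDl sub0r truncnS_gt.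
by rewrite truncn_lt_nat ?oppr_ge0// -subr_gt0 opprK addrC.
Qed.

Lemma exists_shift_gt0 z : exists n : nat, 0 < z + n%:R.
Proof.
by exists (Num.truncn (- z)).+1; rewrite -ltrBlDl sub0r truncnS_gt.
Qed.

Lemma GammaD1 z : z \isn't a Num.int -> Gamma (z + 1) = z * Gamma z.
Proof.
move=> zint; have [n zn0] := exists_shift_gt0 z.
rewrite (@Gamma_shiftE z n.+1)//; last first.
  by rewrite -natr1 addrA ltr_wpDr.
rewrite (@Gamma_shiftE (z + 1) n) ?nonintD ?rpred1//; last first.
  by rewrite addrAC ltr_wpDr.
rewrite big_ord_recl/= addr0.
under [in RHS]eq_bigr do rewrite /bump/= natrD addrA.
rewrite -natr1 [n%:R + 1]addrC addrA invfM mulrCA mulVKf//.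
by apply: contra zint => /eqP ->.
Qed.

Lemma Gamma_neq0 z : z \isn't a Num.int -> Gamma z != 0.
Proof.
move=> zint; have [n zn0] := exists_shift_gt0 z.
rewrite (Gamma_shiftE _ _ zint zn0) mulf_neq0 ?invr_eq0 ?prod_shift_neq0//.
by rewrite gt_eqF// Gamma_integral_gt0.
Qed.

(** The product in the definition contains the factor [- n + n], and division
    by [0] yields [0]. *)
Lemma inv_Gamma_negnat n : (Gamma (- n%:R : R))^-1 = 0.
Proof.
rewrite /Gamma oppr_gt0 ltrn0 opprK natrK big_ord_recr/= addNr mulr0.
by rewrite !invr0 mulr0 invr0.
Qed.

Definition falling_factorial n z : R := \prod_(i < n) (z - i%:R).

Lemma falling_factorialD m n z : falling_factorial (m + n) z =
  falling_factorial m z * falling_factorial n (z - m%:R).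
Proof.
rewrite /falling_factorial big_split_ord/=; congr (_ * _).
by apply: eq_bigr => i _; rewrite natrD opprD addrA.
Qed.

Lemma Gamma_ratio n z : z \isn't a Num.int ->
  Gamma (z + 1) / Gamma (z - n%:R + 1) = falling_factorial n z.
Proof.
move=> zint.
suff -> : Gamma (z + 1) = falling_factorial n z * Gamma (z - n%:R + 1).
  by rewrite mulfK// Gamma_neq0 ?nonintD ?rpred1 ?rpredN ?rpred_nat.
elim: n => [|n IH]; first by rewrite /falling_factorial big_ord0 mul1r subr0.
rewrite IH GammaD1 ?nonintD ?rpredN ?rpred_nat// mulrA.
rewrite /falling_factorial big_ord_recr/=.
by rewrite -natr1 opprD addrA subrK.
Qed.

(** A point strictly between [ceil alpha - 1] and [floor alpha + 1] that is an
    integer lies between [ceil alpha] and [floor alpha], hence equals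
    [alpha]. *)
Lemma near_dnbhs_nonint alpha : \forall z \near alpha^', z \isn't a Num.int.
Proof.
near=> z; apply/negP => /intrP[k zk].
have zlo : (Num.ceil alpha - 1)%:~R < z.
  by near: z; apply: nbhs_dnbhs; apply: lt_nbhsr; exact: ceilB1_lt.
have zhi : z < (Num.floor alpha + 1)%:~R.
  by near: z; apply: nbhs_dnbhs; apply: lt_nbhsl; exact: floorD1_gt.
suff : z == alpha by apply/negP; near: z; exact: nbhs_dnbhs_neq.
move: zlo zhi; rewrite zk !ltr_int ltzD1 ltrBlDr ltzD1.
by rewrite floor_ge_int ceil_le_int eq_le => -> ->.
Unshelve. all: by end_near. Qed.

Lemma continuous_falling_factorial n : continuous (falling_factorial n).
Proof.
apply: continuous_big => [|i _]; first exact: mul_continuous.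
by move=> x; apply: cvgB; [exact: cvg_id|exact: cvg_cst].
Qed.

(** Near [alpha] but off it the argument is not an integer, so the quotient is
    a polynomial in it. The value of the quotient at [alpha] itself, where
    [Gamma] may have poles, does not matter. *)
Lemma cvg_Gamma_ratio n alpha :
  Gamma (z + 1) / Gamma (z - n%:R + 1) @[z --> alpha^']
    --> falling_factorial n alpha.
Proof.
have /continuous_withinNx := @continuous_falling_factorial n alpha.
apply: cvg_trans; apply: near_eq_cvg.
apply: filterS (near_dnbhs_nonint alpha) => z.
by move=> /(Gamma_ratio n).
Qed.

(** * Derivatives of integer order of monomials *)

(** At a positive integer order the arguments of [Gamma] in the complementary
    sum are all negative integers. *)
Lemma complementary_term_nat n (c : nat -> R) x : (0 < n)%N ->
  complementary_term n%:R c x = fun=> 0.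
Proof.
case: n => // n _; apply/funext => j; rewrite /complementary_term ratr_nat.
have -> : - j.+1%:R - n.+1%:R + 1 = - (j + n.+1)%:R :> R.
  by rewrite natrD opprD -natr1 opprD addrAC addrNK.
by rewrite inv_Gamma_negnat !mulr0.
Qed.

(** The classical derivative: the limit of the quotient of Gamma values exists
    and is unique, and the complementary sum vanishes whatever the
    constants. *)
Lemma deriv_monomial_nat n (a : R) alpha : (0 < n)%N ->
  deriv_monomial n%:R a alpha =
  [set monomial (a * falling_factorial n alpha) (alpha - n%:R)].
Proof.
move=> n0.
have lim0 x c : series (complementary_term n%:R c x) = fun=> 0.
  rewrite complementary_term_nat//; apply/funext => k.
  by rewrite /series/= big1.
apply/seteqP; split => [g [_ [l [c [gl gE]]]]|_ ->].
  rewrite ratr_nat in gl.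
  rewrite -(cvg_unique _ gl (cvg_Gamma_ratio n alpha))//.
  apply/funext => x; have [_ ->] := gE x.
  by rewrite lim0 lim_cst// addr0 ratr_nat.
split; first by case=> /eqP + _; rewrite -subr_eq0 opprK natr1 pnatr_eq0.
exists (falling_factorial n alpha), (fun=> 0); rewrite ratr_nat.
split; first exact: cvg_Gamma_ratio.
move=> x; rewrite lim0; split; first exact: is_cvg_cst.
by rewrite lim_cst// addr0.
Qed.

Lemma monomial0 (alpha : R) : monomial 0 alpha = fun=> 0.
Proof. by apply/funext => x; rewrite /monomial mul0r. Qed.

(** A monomial function determines its coefficient (value at [1]), and its
    exponent when the coefficient is nonzero (value at [2]). *)
Lemma monomial_inj (a b alpha beta : R) : monomial a alpha = monomial b beta ->
  b = a /\ (a = 0 \/ beta = alpha).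
Proof.
move=> /funeqP ab.
have ba : b = a by have := ab (PosNum ltr01); rewrite /monomial/= !powR1 !mulr1.
split=> //; have [|a0] := eqVneq a 0; [by left|right].
have := ab (PosNum (ltr0Sn R 1)); rewrite /monomial/= ba.
move=> /(mulfI a0)/(congr1 (@ln R)).
by rewrite !ln_powR => /mulIf -> //; rewrite gt_eqF// ln_gt0// ltr1n.
Qed.

(** If the first derivative is the zero function, it is a monomial of arbitrary
    exponent; its coefficient [0] makes all its derivatives zero. *)
Lemma deriv_set_deriv_monomial m n (a : R) alpha : (0 < m)%N -> (0 < n)%N ->
  deriv_set n%:R (deriv_monomial m%:R a alpha) =
  deriv_monomial (m + n)%:R a alpha.
Proof.
move=> m0 n0; rewrite !deriv_monomial_nat ?addn_gt0 ?m0//.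
rewrite falling_factorialD mulrA natrD opprD addrA.
apply/seteqP; split => [g [b [beta [/= bE]]]|_ ->]; last first.
  exists (a * falling_factorial m alpha), (alpha - m%:R).
  by split => //; rewrite deriv_monomial_nat.
rewrite deriv_monomial_nat// => ->.
have [<- [b0|<-//]] := monomial_inj _ _ _ _ bE.
by rewrite b0 !mul0r !monomial0.
Qed.

End Gamma_function.

Theorem theorem3p8 (R : realType) (s1 s2 : nat) (a alpha : R)
    (hs1 : (0 < s1)%N) (hs2 : (0 < s2)%N) :
  [/\ deriv_set s1%:R (deriv_monomial s2%:R a alpha)
        = deriv_set s2%:R (deriv_monomial s1%:R a alpha),
      deriv_set s2%:R (deriv_monomial s1%:R a alpha)
        = deriv_monomial (s1 + s2)%:R a alpha
    & exists h : {posnum R} -> R,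
        deriv_monomial (s1 + s2)%:R a alpha = [set h] ].
Proof.
rewrite !deriv_set_deriv_monomial// (addnC s2); split=> //.
by eexists; apply: deriv_monomial_nat; rewrite addn_gt0 hs1.
Qed.
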